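(* Let $K, L \ge 1$ be integers, $d=\sum_{k=1}^K d_k$, and write $\bm w=[\bm w_1^{\mathsf T},\dots,\bm w_K^{\mathsf T}]^{\mathsf T}\in\mathbb R^d$ with $\bm w_k\in\mathbb R^{d_k}$. Suppose $F:\mathbb R^d\to\mathbb R$ has the form $$F(\bm w)=\frac1L\sum_{i=1}^L f_i(\bm w)+\lambda\sum_{k=1}^K r_k(\bm w),$$ where the sample losses $f_i$ have the vertical-FL structure: for each $i\in[L]$, $k\in[K]$ there are continuously differentiable local prediction functions $\bm w_k\mapsto g_k(\bm w_k,\bm x_{i,k})\in\mathbb R$ (with gradient $\nabla g_{k,i}(\bm w_k)=\partial g_k(\bm w_k,\bm x_{i,k})/\partial \bm w_k$) and a differentiable function $G_i:\mathbb R\to\mathbb R$ such that, with $s_i(\bm w)=\sum_{k=1}^K g_k(\bm w_k,\bm x_{i,k})$, $$\frac{\partial f_i(\bm w)}{\partial \bm w_k}=G_i\big(s_i(\bm w)\big)\,\nabla g_{k,i}(\bm w_k).$$ Denote $\nabla_k F(\bm w)=\partial F(\bm w)/\partial\bm w_k$. Assume $F$ is $\alpha$-strongly convex and $\beta$-smooth on $\mathbb R^d$ with $0<\alpha\le\beta$, and let $\bm w^*$ be its minimizer. Consider the noisy iteration, started from a deterministic $\bm w^{(0)}$, with learning rate $1/\beta$: $$\bm w_k^{(t+1)}=\bm w_k^{(t)}-\frac1\beta\Big(\nabla_k F(\bm w^{(t)})+\bm e_k^{(t)}\Big),\qquad \bm e_k^{(t)}=\frac1L\sum_{i=1}^L\Big(G_i'\big(s_i(\bm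 w^{(t)})\big)\,n^{(t)}_{\mathrm{UL}}(i)+n^{(t)}_{\mathrm{DL},k}(i)\Big)\nabla g_{k,i}(\bm w_k^{(t)}),$$ for $k\in[K]$, $t=0,1,\dots$, where the real random variables $n^{(t)}_{\mathrm{UL}}(i)\sim\mathcal N(0,\sigma^2_{\mathrm{UL}}(t))$ and $n^{(t)}_{\mathrm{DL},k}(i)\sim\mathcal N(0,\sigma^2_{\mathrm{DL},k}(t))$ (with deterministic variances) are all mutually independent over $i,k,t$ and between uplink and downlink. (This is the first-order model in which the device's received estimate of $G_i$ is $G_i(s_i)+G_i'(s_i)n_{\mathrm{UL}}(i)+n_{\mathrm{DL},k}(i)$.) Let $\rho=1-\alpha/\beta$ and define $$\Phi_{1,k}(t)=\sum_{i=1}^L G_i'\big(s_i(\bm w^{(t)})\big)^2\big\|\nabla g_{k,i}(\bm w^{(t)}_k)\big\|^2,\qquad \Phi_{2,k}(t)=\sum_{i=1}^L\big\|\nabla g_{k,i}(\bm w^{(t)}_k)\big\|^2$$ (for linear local predictors $g_k(\bm w_k,\bm x_{i,k})=\bm w_k^{\mathsf T}\bm x_{i,k}$ one has $\nabla g_{k,i}=\bm x_{i,k}$). Then for every $T\ge1$, $$\mathbb E\big[F(\bm w^{(T)})-F(\bm w^* )\big]\le \rho^T\big(F(\bm w^{(0)})-F(\bm w^* )\big)+\frac{3}{2L^2\beta}\,B(T),$$ where $$B(T)=\sum_{t=0}^{T-1}\rho^{T-t-1}\sum_{k=1}^K\Big(\sigma^2_{\mathrm{UL}}(t)\,\mathbb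 E[\Phi_{1,k}(t)]+\sigma^2_{\mathrm{DL},k}(t)\,\mathbb E[\Phi_{2,k}(t)]\Big).$$
   Context: Vertical federated learning: $K$ devices each hold a disjoint block $\bm x_{i,k}\in\mathbb R^{d_k}$ of the features of each of $L$ training samples and a sub-model $\bm w_k$; the server aggregates local predictions $s_i=\sum_k g_k(\bm w_k,\bm x_{i,k})$ and returns $G_i(s_i)$, from which each device forms its partial gradient. $\alpha$-strong convexity: $F(\bm y)\ge F(\bm x)+\nabla F(\bm x)^{\mathsf T}(\bm y-\bm x)+\frac\alpha2\|\bm y-\bm x\|^2$ for all $\bm x,\bm y$; $\beta$-smoothness: $F(\bm y)\le F(\bm x)+\nabla F(\bm x)^{\mathsf T}(\bm y-\bm x)+\frac\beta2\|\bm y-\bm x\|^2$ for all $\bm x,\bm y$. $\sigma^2_{\mathrm{UL}}(t)$ and $\sigma^2_{\mathrm{DL},k}(t)$ are the effective uplink and downlink communication-noise variances in round $t$; expectations are over all these noises. *)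

(* Defs.v *)
From HB Require Import structures.
From mathcomp Require Import all_boot all_order all_algebra.
From mathcomp Require Import all_classical all_reals all_analysis.
Unset Implicit Arguments. Unset Printing Implicit Defensive.
Import Order.TTheory GRing.Theory Num.Theory.
Import numFieldNormedType.Exports.
Local Open Scope classical_set_scope.
Local Open Scope ring_scope.

Section Defs.
Context {R : realType}.

(** Euclidean inner product and squared Euclidean norm on row vectors R^n.
    (NB: MathComp's `|_| on matrices is the sup norm, so we do not use it.) *)
Definition dotr {n} (u v : 'rV[R]_n) : R := \sum_(j < n) u 0 j * v 0 j.
Definition sqnorm {n} (u : 'rV[R]_n) : R := dotr u u.

Definition is_gradient {n} (f : 'rV[R]_n -> R) (x g : 'rV[R]_n) : Prop :=
  differentiable f x /\ forall v, 'd f x v = dotr g v.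

Definition embed {K : nat} {dk : 'I_K -> nat} (k : 'I_K) (u : 'rV[R]_(dk k))
  : 'rV[R]_(\sum_(j < K) dk j) :=
  @mxrow R K dk 1 (fun j => if j == k then conform_mx (0 : 'rV[R]_(dk j)) u else 0).

Definition is_partial_gradient {K : nat} {dk : 'I_K -> nat}
  (f : 'rV[R]_(\sum_(j < K) dk j) -> R) (w : 'rV[R]_(\sum_(j < K) dk j))
  (k : 'I_K) (g : 'rV[R]_(dk k)) : Prop :=
  is_gradient (fun u : 'rV[R]_(dk k) => f (w + embed k u)) 0 g.

Definition centered_gaussian {d} {T : measurableType d} (P : probability T R)
  (X : T -> R) (v : R) : Prop :=
  measurable_fun setT X /\
  forall B : set R, measurable B ->
    P (X @^-1` B) = if v == 0 then \d_(0 : R) B else normal_prob 0 (Num.sqrt v) B.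

Definition mutually_independent {d} {T : measurableType d} (P : probability T R)
  {I : eqType} (X : I -> T -> R) : Prop :=
  (forall i, measurable_fun setT (X i)) /\
  forall (J : seq I) (B : I -> set R), uniq J -> (forall j, measurable (B j)) ->
    P (\big[setI/setT]_(j <- J) (X j @^-1` B j)) =
    (\prod_(j <- J) P (X j @^-1` B j))%E.

Definition noise_family {d} {T : measurableType d} {K L : nat}
  (nUL : nat -> 'I_L -> T -> R) (nDL : nat -> 'I_K -> 'I_L -> T -> R)
  (j : ((nat * 'I_L) + (nat * 'I_K * 'I_L))%type) : T -> R :=
  match j with
  | inl (t, i) => nUL t i
  | inr (t, k, i) => nDL t k i
  end.

Definition blk {K : nat} {dk : 'I_K -> nat} (w : 'rV[R]_(\sum_(j < K) dk j))
  (k : 'I_K) : 'rV[R]_(dk k) := @submxrow R K dk 1 w k.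

Section Model.
Variables (K L : nat) (dk : 'I_K -> nat).
Local Notation V := 'rV[R]_(\sum_(j < K) dk j).
Variables (gk : forall k : 'I_K, 'rV[R]_(dk k) -> 'rV[R]_(dk k) -> R)
          (x : 'I_L -> forall k : 'I_K, 'rV[R]_(dk k))
          (dg : forall k : 'I_K, 'I_L -> 'rV[R]_(dk k) -> 'rV[R]_(dk k))
          (dG : 'I_L -> R -> R).

Definition pred_s (i : 'I_L) (w : V) : R :=
  \sum_(k < K) gk k (blk w k) (x i k).

Definition noise_blk (nUL : 'I_L -> R) (nDL : 'I_K -> 'I_L -> R) (w : V)
  (k : 'I_K) : 'rV[R]_(dk k) :=
  (L%:R)^-1 *: \sum_(i < L)
      ((dG i (pred_s i w) * nUL i + nDL k i) *: dg k i (blk w k)).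

Fixpoint iterate (beta : R) (gradF : V -> V) (w0 : V)
  (nUL : nat -> 'I_L -> R) (nDL : nat -> 'I_K -> 'I_L -> R) (t : nat) : V :=
  match t with
  | 0%N => w0
  | t'.+1 =>
      let w := iterate beta gradF w0 nUL nDL t' in
      @mxrow R K dk 1 (fun k => blk w k
                       - beta^-1 *: (blk (gradF w) k
                                     + noise_blk (nUL t') (nDL t') w k))
  end.

Definition Phi1 (w : V) (k : 'I_K) : R :=
  \sum_(i < L) (dG i (pred_s i w)) ^+ 2 * sqnorm (dg k i (blk w k)).
Definition Phi2 (w : V) (k : 'I_K) : R :=
  \sum_(i < L) sqnorm (dg k i (blk w k)).

End Model.
End Defs.

(* Main.v *)
Require Import Defs.
From HB Require Import structures.
From mathcomp Require Import all_boot all_order all_algebra.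
From mathcomp Require Import all_classical all_reals all_analysis.
From mathcomp Require Import measurable_realfun ring lra.
Import Order.TTheory GRing.Theory Num.Theory.
Import numFieldNormedType.Exports.
Local Open Scope classical_set_scope.
Local Open Scope ring_scope.

(** Let D(w) be the optimality gap.  Smoothness at the step 1/beta and the
    Polyak-Lojasiewicz inequality give, for every realisation of the noise,
    D(next w) <= rho D(w) + |e|^2 / (2 beta), without any cross term.  The
    aggregated noise e is linear in the current noises, with coefficients
    depending on the past only.  Integrating out one Gaussian n of variance v
    at a time, Tonelli on (Omega, sigma(past)) x R gives
    E (A + B n)^2 <= E A^2 + 3 v E B^2 in the extended reals, with no
    integrability condition: n is symmetric and E n^2 <= 3 v.  This crude second
    moment is affordable because of the 3 in the constant 3 / (2 L^2 beta). *)

(** * Second moments under a centered normal law *)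

(** Dominating by the normal density of twice the standard deviation reduces the
    second moment bound to the normalisation of that density. *)
Lemma normal_second_moment_dom (R : realType) (s y : R) : 0 < s ->
  y ^+ 2 * normal_pdf 0 s y <= 3 * s ^+ 2 * normal_pdf 0 (2 * s) y.
Proof.
move=> s0; have s20 : 2 * s != 0 by rewrite mulf_neq0 // gt_eqF.
rewrite !normal_pdfE ?(gt_eqF s0)//.
have -> : normal_peak (2 * s) = normal_peak s / 2.
  rewrite /normal_peak -invfM; congr (_^-1).
  rewrite (_ : (2 * s) ^+ 2 * pi *+ 2 = (2 ^+ 2) * (s ^+ 2 * pi *+ 2)); last first.
    by rewrite !mulr2n; ring.
  by rewrite sqrtrM ?exprn_ge0// sqrtr_sqr ger0_norm// mulrC.
set p := normal_peak s; have p0 : 0 <= p by exact: normal_peak_ge0.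
rewrite /normal_fun !subr0.
set u := y ^+ 2 / s ^+ 2.
have u0 : 0 <= u by rewrite divr_ge0 ?sqr_ge0.
have yE : y ^+ 2 = s ^+ 2 * u by rewrite /u mulrC divfK// sqrf_eq0 gt_eqF.
clearbody u; have sn0 : s != 0 by rewrite gt_eqF.
(* The exponent u / 2 is split so that u / 8, the exponent for deviation [2 * s], is common to both
   sides. *)
have -> : - y ^+ 2 / (s ^+ 2 *+ 2) = - (3 * u / 8) + - (u / 8).
  by rewrite yE mulr2n; field;
    rewrite -mulr2n mulrn_eq0 ?expf_eq0 ?mulf_eq0 ?pnatr_eq0 (negPf sn0).
have -> : - y ^+ 2 / ((2 * s) ^+ 2 *+ 2) = - (u / 8).
  by rewrite yE mulr2n; field;
    rewrite -mulr2n mulrn_eq0 ?expf_eq0 ?mulf_eq0 ?pnatr_eq0 (negPf sn0).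
rewrite expRD yE; set E := expR (- (u / 8)); have E0 : 0 <= E by exact: expR_ge0.
(* This is what remains after cancelling [s ^+ 2], [p] and [E]; the peak for [2 * s] is half of [p],
   which turns 3 into 3 / 2. *)
have key : u * expR (- (3 * u / 8)) <= 3 / 2.
  rewrite expRN ler_pdivrMr ?expR_gt0//.
  have h := expR_ge1Dx (3 * u / 16).
  have -> : 3 * u / 8 = 3 * u / 16 + 3 * u / 16 by field.
  rewrite expRD; set z := expR _ in h *.
  have a0 : 0 <= 1 + 3 * u / 16 by lra.
  (* The exponential is at least the square of 1 + 3 u / 16. Subtracting u from 3 / 2 times this
     square leaves a quadratic with positive minimum, attained at u = 112 / 27. *)
  have := ler_pM a0 a0 h h; have := sqr_ge0 (u - 112 / 27); lra.
have s2 : 0 <= s ^+ 2 * p * E by rewrite !mulr_ge0// ltW.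
have := ler_wpM2l s2 key; set w := expR _; lra.
Qed.

Lemma symmetric_normal_pdf (R : realType) (s y : R) : s != 0 ->
  normal_pdf 0 s (- y) = normal_pdf 0 s y.
Proof. by move=> s0; rewrite !normal_pdfE// /normal_fun !subr0 sqrrN. Qed.

Section normal_law.
Context (R : realType).
Local Notation mu := (@lebesgue_measure R).
Local Open Scope ereal_scope.

Lemma ge0_integral_oppr (f : R -> \bar R) :
  measurable_fun [set: R] f -> (forall y, 0 <= f y) ->
  \int[mu]_y f (- y)%R = \int[mu]_y f y.
Proof.
move=> mf f0.
rewrite -(@ge0_integral_pushforward _ _ (measurableTypeR R) (measurableTypeR R) R
  (-%R) _ mu setT f) //.
by apply: eq_measure_integral => A mA _; exact: lebesgue_measureN.
Qed.

(** The Radon-Nikodym derivative and [normal_pdf] have equal integrals over every measurable set,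
    hence agree almost everywhere. Nonnegativity of [f] replaces integrability. *)
Lemma ge0_integral_normal_prob (s : R) (f : R -> \bar R) :
  measurable_fun [set: R] f -> (forall y, 0 <= f y) ->
  \int[normal_prob 0 s]_y f y = \int[mu]_y (f y * (normal_pdf 0 s y)%:E).
Proof.
move=> mf f0; have dom := normal_prob_dominates 0 s.
rewrite -(Radon_Nikodym_SigmaFinite.change_of_variables dom)//.
set g := Radon_Nikodym_SigmaFinite.f _ _.
have mpdf : measurable_fun setT (fun y => (normal_pdf 0 s y)%:E).
  by apply/measurable_EFinP; exact: measurable_normal_pdf.
have ig : mu.-integrable setT g by exact: Radon_Nikodym_SigmaFinite.f_integrable.
have mg : measurable_fun setT g by exact: measurable_int ig.
apply: ae_eq_integral => //.
- exact: emeasurable_funM.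
- exact: emeasurable_funM.
- have : ae_eq mu setT g (fun y => (normal_pdf 0 s y)%:E).
    apply: integral_ae_eq => // E _ mE.
    by rewrite -Radon_Nikodym_SigmaFinite.f_integral.
  by apply: filterS => y /[apply] ->.
Qed.

(** By symmetry of the law the integrals for [b] and [- b] coincide; adding them removes the cross
    term 2 a b y pointwise, so no first moment is computed. *)
Lemma normal_affine_second_moment (s a b : R) : (0 < s)%R ->
  \int[normal_prob 0 s]_y ((a + b * y) ^+ 2)%:E <=
  (a ^+ 2 + 3 * s ^+ 2 * b ^+ 2)%:E.
Proof.
move=> s0; have sn0 : s != 0%R by rewrite gt_eqF.
have mpdf t : measurable_fun setT (normal_pdf 0 t : R -> R).
  exact: measurable_normal_pdf.
have pdf0 t (y : R) : (0 <= normal_pdf 0 t y)%R by exact: normal_pdf_ge0.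
have mq c : measurable_fun setT (fun y : R => (a + c * y) ^+ 2)%R.
  by apply: measurable_funX; apply: measurable_funD => //; exact: measurable_funM.
pose I c := \int[normal_prob 0 s]_y ((a + c * y) ^+ 2)%:E.
have IE c : I c = \int[mu]_y ((a + c * y) ^+ 2 * normal_pdf 0 s y)%:E.
  rewrite /I ge0_integral_normal_prob//; first exact/measurable_EFinP.
  by move=> y; rewrite lee_fin sqr_ge0.
have mqp c t :
  measurable_fun setT (fun y : R => ((a + c * y) ^+ 2 * normal_pdf 0 t y)%:E).
  by apply/measurable_EFinP; exact: measurable_funM.
have qp0 c t y : 0 <= ((a + c * y) ^+ 2 * normal_pdf 0 t y)%:E.
  by rewrite lee_fin mulr_ge0// exprn_even_ge0.
have Isym : I (- b)%R = I b.
  rewrite !IE -[RHS](ge0_integral_oppr _ (mqp b s) (qp0 b s)).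
    by apply: eq_integral => y _; rewrite symmetric_normal_pdf// mulrN mulNr.
have mp (c t : R) : measurable_fun setT (fun y : R => (c * normal_pdf 0 t y)%:E).
  by apply/measurable_EFinP; exact: measurable_funM.
(* Densities have mass one, so constants become integrals and the bound can be checked under the
   integral sign. *)
have Ic (c t : R) : (0 <= c)%R -> c%:E = \int[mu]_y (c * normal_pdf 0 t y)%:E.
  move=> c0; under eq_integral do rewrite EFinM.
  have mE : measurable_fun setT (fun y : R => (normal_pdf 0 t y)%:E).
    exact/measurable_EFinP.
  have p0 (y : R) : setT y -> 0 <= (normal_pdf 0 t y)%:E by rewrite lee_fin.
  by rewrite ge0_integralZl// integral_normal_pdf mule1.
have a0 : (0 <= 2 * a ^+ 2)%R by rewrite mulr_ge0// exprn_even_ge0.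
have b0 : (0 <= 6 * s ^+ 2 * b ^+ 2)%R.
  by rewrite mulr_ge0 ?exprn_even_ge0// mulr_ge0// exprn_even_ge0.
(* After symmetrisation the integrand is 2 a^2 + 2 b^2 y^2 times the density;
   [normal_second_moment_dom] bounds the second part, whence 6 = 2 * 3. *)
have I2 : I b + I b <= (2 * a ^+ 2)%:E + (6 * s ^+ 2 * b ^+ 2)%:E.
  rewrite -{1}Isym !IE -ge0_integralD//; [|exact: mqp|exact: mqp].
  rewrite (Ic _ s a0) (Ic _ (2 * s)%R b0) -ge0_integralD//; first last.
  - exact: mp.
  - by move=> y _; rewrite lee_fin mulr_ge0.
  - exact: mp.
  - by move=> y _; rewrite lee_fin mulr_ge0.
  apply: ge0_le_integral => //.
  - by move=> y _; exact: adde_ge0.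
  - by apply: emeasurable_funD; exact: mqp.
  - by apply: emeasurable_funD; exact: mp.
  - move=> y _; rewrite -!EFinD lee_fin.
    have := ler_wpM2l (sqr_ge0 b) (normal_second_moment_dom _ s y s0).
    set p := normal_pdf _ _ _; set q := normal_pdf _ _ _ => h.
    suff : (2 * b ^+ 2 * y ^+ 2 * p <= 6 * s ^+ 2 * b ^+ 2 * q)%R by lra.
    by lra.
have : 0 <= I b by apply: integral_ge0 => y _; rewrite lee_fin sqr_ge0.
rewrite -/(I b); move: I2; case: (I b) => [r| |]//.
by rewrite -!EFinD !lee_fin => h _; lra.
Qed.

End normal_law.

(** * Noise independent of the past *)

Section independent_noise.
Context {R : realType} {d d'} {Omega : measurableType d} {T : measurableType d'}.
Context (P : probability Omega R).
Local Open Scope ereal_scope.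

(** Variance 0 stands for the Dirac mass at 0 and is treated apart; otherwise the bound for normal
    laws applies with deviation [Num.sqrt v]. *)
Lemma centered_gaussian_affine_second_moment (X : {mfun Omega >-> R})
    (v a b : R) : (0 <= v)%R -> centered_gaussian P X v ->
  \int[distribution P X]_y ((a + b * y) ^+ 2)%:E <=
  (a ^+ 2 + 3 * v * b ^+ 2)%:E.
Proof.
move=> v0 [_ lawX]; have [vE|vn0] := eqVneq v 0%R.
  rewrite (eq_measure_integral (\d_(0%R : R))); last first.
    by move=> A mA _; have := lawX A mA; rewrite vE eqxx.
  rewrite integral_dirac//.
    by rewrite diracT mul1e mulr0 addr0 vE mulr0 mul0r addr0.
  apply/measurable_EFinP; apply: measurable_funX.
  by apply: measurable_funD => //; exact: measurable_funM.
pose N : probability (measurableTypeR R) R := normal_prob 0 (Num.sqrt v).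
have mid : measurable_fun setT (idfun : measurableTypeR R -> R).
  by move=> _ A mA; rewrite setTI preimage_id.
pose id' : {mfun measurableTypeR R >-> R} :=
  HB.pack (idfun : measurableTypeR R -> R) (isMeasurableFun.Build _ _ _ _ _ mid).
have -> : \int[distribution P X]_y ((a + b * y) ^+ 2)%:E =
    \int[distribution N id']_y ((a + b * y) ^+ 2)%:E.
  apply: eq_measure_integral => A mA _.
  by have := lawX A mA; rewrite (negbTE vn0).
rewrite ge0_integral_distribution; last 2 first.
- apply/measurable_EFinP; apply: measurable_funX.
  by apply: measurable_funD => //; exact: measurable_funM.
- by move=> y; rewrite lee_fin sqr_ge0.
rewrite -[in leRHS](sqr_sqrtr v0); apply: normal_affine_second_moment.
by rewrite sqrtr_gt0 lt_neqAle eq_sym vn0.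
Qed.

(** Independence on rectangles identifies the law of (Z, X) with a product measure. By Tonelli, X is
    integrated first, with [a] and [b] frozen at the value of Z. *)
Lemma independent_affine_second_moment (Z : {mfun Omega >-> T})
    (X : {mfun Omega >-> R}) (v : R) (a b : T -> R) :
  (0 <= v)%R -> centered_gaussian P X v ->
  (forall A B, measurable A -> measurable B ->
     P (Z @^-1` A `&` X @^-1` B) = P (Z @^-1` A) * P (X @^-1` B)) ->
  measurable_fun setT a -> measurable_fun setT b ->
  \int[P]_om ((a (Z om) + b (Z om) * X om) ^+ 2)%:E <=
  \int[P]_om (a (Z om) ^+ 2)%:E + (3 * v)%:E * \int[P]_om (b (Z om) ^+ 2)%:E.
Proof.
move=> v0 gX ind ma mb.
have mZX : measurable_fun setT (fun om => (Z om, X om)).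
  by apply: measurable_fun_pair; exact: measurable_funP.
pose ZX : {mfun Omega >-> (T * R)%type} :=
  HB.pack (fun om => (Z om, X om)) (isMeasurableFun.Build _ _ _ _ _ mZX).
pose phi (p : T * R) := ((a p.1 + b p.1 * p.2) ^+ 2)%:E.
have mphi : measurable_fun setT phi.
  apply/measurable_EFinP; apply: measurable_funX; apply: measurable_funD.
    exact: measurableT_comp.
  by apply: measurable_funM => //; exact: measurableT_comp.
have phi0 p : 0 <= phi p by rewrite lee_fin sqr_ge0.
have ma2 : measurable_fun setT (fun z => (a z ^+ 2)%:E).
  by apply/measurable_EFinP; exact: measurable_funX.
have mb2 : measurable_fun setT (fun z => (b z ^+ 2)%:E).
  by apply/measurable_EFinP; exact: measurable_funX.
rewrite -[leLHS](@ge0_integral_distribution _ _ _ _ _ P ZX phi mphi phi0).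
have -> : \int[distribution P ZX]_p phi p =
    \int[distribution P Z \x distribution P X]_p phi p.
  apply: eq_measure_integral => A mA _; apply/esym.
  apply: product_measure_unique => // B C mB mC; exact: ind.
rewrite fubini_tonelli1//.
rewrite -(@ge0_integral_distribution _ _ _ _ _ P Z _ ma2); last first.
  by move=> z; rewrite lee_fin sqr_ge0.
rewrite -(@ge0_integral_distribution _ _ _ _ _ P Z _ mb2); last first.
  by move=> z; rewrite lee_fin sqr_ge0.
have v30 : (0 <= 3 * v)%R by rewrite mulr_ge0.
rewrite -ge0_integralZl//; last by move=> z _; rewrite lee_fin sqr_ge0.
rewrite -ge0_integralD//; first last.
- exact: emeasurable_funM.
- by move=> z _; rewrite -EFinM lee_fin mulr_ge0 ?sqr_ge0.
- by move=> z _; rewrite lee_fin sqr_ge0.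
apply: ge0_le_integral => //.
- by move=> z _; apply: integral_ge0.
- exact: measurable_fun_fubini_tonelli_F.
- by apply: emeasurable_funD => //; exact: emeasurable_funM.
- move=> z _; rewrite -EFinM -EFinD.
  exact: (centered_gaussian_affine_second_moment X v (a z) (b z) v0 gX).
Qed.

End independent_noise.

(** * Sigma-algebras generated by part of the noise family *)

Section past.
Context {R : realType} {d} {Omega : measurableType d} (P : probability Omega R).
Context {I : eqType} (X : I -> Omega -> R).

(** These finite intersections form a pi-system, on which mutual independence can be applied
    directly. *)
Definition cylinders (S : set I) : set (set Omega) :=
  [set A | exists J : seq I, exists B : I -> set R,
    [/\ uniq J, (forall j, j \in J -> S j), (forall j, measurable (B j)) &
        A = \big[setI/setT]_(j <- J) (X j @^-1` B j)]].

(** The carrier is still Omega; only the sigma-algebra is smaller. *)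
Definition past (S : set I) := g_sigma_algebraType (cylinders S).

Lemma bigsetI_seqP (J : seq I) (A : I -> set Omega) om :
  (\big[setI/setT]_(j <- J) A j) om <-> (forall j, j \in J -> A j om).
Proof.
elim: J => [|i J IH]; first by rewrite big_nil.
rewrite big_cons; split => [[Ai /IH AJ] j|h].
  by rewrite inE => /predU1P[->|/AJ].
split; first by apply: h; rewrite mem_head.
by apply/IH => j jJ; apply: h; rewrite inE jJ orbT.
Qed.

(** Two cylinders are put over the union of their index lists, with the constraint [setT] at indices
    missing from one list. *)
Lemma cylindersI S : setI_closed (cylinders S).
Proof.
move=> _ _ [J1 [B1 [_ S1 m1 ->]]] [J2 [B2 [_ S2 m2 ->]]].
exists (undup (J1 ++ J2)), (fun j => (if j \in J1 then B1 j else setT) `&`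
                                     (if j \in J2 then B2 j else setT)).
split; first exact: undup_uniq.
- by move=> j; rewrite mem_undup mem_cat => /orP[/S1|/S2].
- by move=> j; apply: measurableI; case: ifP.
- apply/seteqP; split => om.
    move=> [/bigsetI_seqP h1 /bigsetI_seqP h2]; apply/bigsetI_seqP => j _.
    by split => /=; case: ifP => // jJ; [exact: h1|exact: h2].
  move=> /bigsetI_seqP h; split; apply/bigsetI_seqP => j jJ.
    by have := h j; rewrite mem_undup mem_cat jJ => /(_ isT)[].
  by have := h j; rewrite mem_undup mem_cat jJ orbT => /(_ isT)[].
Qed.

Lemma cylinders_subset S S' : S `<=` S' -> cylinders S `<=` cylinders S'.
Proof.
by move=> SS' A [J [B [uJ SJ mB ->]]]; exists J, B; split => // j /SJ /SS'.
Qed.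

Lemma measurable_past_subset S S' (f : Omega -> R) : S `<=` S' ->
  measurable_fun [set: past S] (f : past S -> R) ->
  measurable_fun [set: past S'] (f : past S' -> R).
Proof.
move=> SS' mf _ B mB; have := mf measurableT B mB.
by apply: sub_smallest2r; [exact: smallest_sigma_algebra|exact: cylinders_subset].
Qed.

Lemma measurable_noise_past S i : S i ->
  measurable_fun [set: past S] (X i : past S -> R).
Proof.
move=> Si _ B mB; apply: sub_sigma_algebra; exists [:: i], (fun=> B).
split => //; first by move=> j; rewrite inE => /eqP ->.
by rewrite big_seq1 setTI.
Qed.

Context (indX : mutually_independent P X).

Lemma cylinders_measurable S : cylinders S `<=` measurable.
Proof.
move=> _ [J [B [_ _ mB ->]]]; apply: bigsetI_measurable => j _.
by rewrite -[X in measurable X]setTI; exact: indX.1.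
Qed.

Lemma measurable_from_past S (f : Omega -> R) :
  measurable_fun [set: past S] (f : past S -> R) ->
  measurable_fun [set: Omega] f.
Proof.
move=> mf _ B mB; have := mf measurableT B mB.
apply: smallest_sub; first exact: sigma_algebra_measurable.
exact: cylinders_measurable.
Qed.

(** For fixed [B], both sides are finite measures in [A] that agree on the pi-system of cylinders,
    hence on the sigma-algebra it generates. *)
Lemma past_independent (S : set I) (i : I) (A : set Omega) (B : set R) :
  ~ S i -> <<s cylinders S >> A -> measurable B ->
  P (A `&` X i @^-1` B) = (P A * P (X i @^-1` B))%E.
Proof.
move=> Si sA mB.
have mXB : measurable (X i @^-1` B).
  by rewrite -[X in measurable X]setTI; exact: indX.1.
have PXBfin : P (X i @^-1` B) \is a fin_num by exact: fin_num_measure.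
have c0 : 0 <= fine (P (X i @^-1` B)) by exact: fine_ge0.
rewrite muleC -[X in _ = (X * _)%E]fineK//.
pose m2 : measure Omega R := mscale (NngNum c0) P.
pose m1 : measure Omega R := mrestr P mXB.
suff : m1 A = m2 A by [].
apply: (g_sigma_algebra_measure_unique (cylinders S) _ (fun=> setT)) => //.
- exact: cylinders_measurable.
- by move=> _; exists [::], (fun=> setT); split => //; rewrite big_nil.
- by rewrite bigcup_const.
- exact: cylindersI.
- move=> _ [J [C [uJ SJ mC ->]]].
  rewrite /m1 /m2/= /mrestr /mscale/= fineK//.
  have iJ : i \notin J by apply/negP => /SJ.
  (* One family of constraints serves both [J] and [i :: J]; comparing the two product formulas
     isolates the factor of index [i]. *)
  pose C' j := if j == i then B else C j.
  have mC' j : measurable (C' j) by rewrite /C'; case: ifP.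
  have C'J j : j \in J -> C' j = C j.
    by rewrite /C'; case: eqP => // -> ; rewrite (negbTE iJ).
  have E1 : \big[setI/setT]_(j <- J) (X j @^-1` C j) =
            \big[setI/setT]_(j <- J) (X j @^-1` C' j).
    by apply: eq_big_seq => j jJ; rewrite C'J.
  have := indX.2 (i :: J) C'; rewrite /= iJ uJ => /(_ isT mC').
  rewrite !big_cons -(indX.2 J C' uJ mC') -E1 /C' eqxx => <-.
  by rewrite setIC.
- by move=> _; rewrite /m1/= /mrestr setTI ltey_eq fin_num_measure.
Qed.

(** The past is encoded as a random variable: the identity map from Omega to Omega with the smaller
    sigma-algebra. *)
Lemma past_affine_second_moment (S : set I) (i : I) (v : R) (a b : Omega -> R) :
  0 <= v -> centered_gaussian P (X i) v -> ~ S i ->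
  measurable_fun [set: past S] (a : past S -> R) ->
  measurable_fun [set: past S] (b : past S -> R) ->
  (\int[P]_om ((a om + b om * X i om) ^+ 2)%:E <=
   \int[P]_om (a om ^+ 2)%:E + (3 * v)%:E * \int[P]_om (b om ^+ 2)%:E)%E.
Proof.
move=> v0 gX Si ma mb.
have mid : measurable_fun [set: Omega] (id : Omega -> past S).
  move=> _ B mB; rewrite setTI; move: mB.
  apply: smallest_sub; first exact: sigma_algebra_measurable.
  exact: cylinders_measurable.
pose Z : {mfun Omega >-> past S} :=
  HB.pack (id : Omega -> past S) (isMeasurableFun.Build _ _ _ _ _ mid).
pose X' : {mfun Omega >-> R} :=
  HB.pack (X i) (isMeasurableFun.Build _ _ _ _ _ (indX.1 i)).
apply: (independent_affine_second_moment P Z X' v a b) => // A B mA mB.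
exact: (past_independent S).
Qed.

Lemma past_sum_second_moment (S : set I) (J : seq I) (v : I -> R)
    (h : I -> Omega -> R) : uniq J -> (forall j, j \in J -> ~ S j) ->
  (forall j, 0 <= v j) -> (forall j, centered_gaussian P (X j) (v j)) ->
  (forall j, measurable_fun [set: past S] (h j : past S -> R)) ->
  (\int[P]_om ((\sum_(j <- J) h j om * X j om) ^+ 2)%:E <=
   \sum_(j <- J) (3 * v j)%:E * \int[P]_om (h j om ^+ 2)%:E)%E.
Proof.
move=> + + v0 gX mh; elim: J => [|i J IH] /=.
  move=> _ _; under eq_integral do rewrite big_nil expr0n.
  by rewrite integral0 big_nil.
move=> /andP[iJ uJ] SJ; rewrite big_cons.
pose S' := S `|` [set j | j \in J].
(* The default 0 off [J] makes every summand measurable for the enlarged past, as [measurable_sum]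
   asks, without changing the sum. *)
pose A om := \sum_(j <- J) h j om * (if j \in J then X j om else 0).
have mA : measurable_fun [set: past S'] (A : past S' -> R).
  apply: measurable_sum => j; apply: measurable_funM.
    by apply: measurable_past_subset (mh j); left.
  have [jJ|_] := boolP (j \in J); last exact: measurable_cst.
  by apply: measurable_noise_past; right.
have AE om : \sum_(j <- J) h j om * X j om = A om.
  by apply: eq_big_seq => j ->.
have mhi : measurable_fun [set: past S'] (h i : past S' -> R).
  by apply: measurable_past_subset (mh i); left.
have S'i : ~ S' i by move=> [|/=]; [apply: SJ; rewrite mem_head|exact/negP].
under eq_integral do rewrite big_cons AE addrC.
apply: (le_trans (past_affine_second_moment S' i (v i) A (h i)
  (v0 i) (gX i) S'i mA mhi)).
rewrite addeC leeD2l//; under eq_integral do rewrite -AE.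
by apply: IH => // j jJ; apply: SJ; rewrite inE jJ orbT.
Qed.

End past.

(** * Noisy gradient step *)

Section euclidean.
Context {R : realType} {n : nat}.
Implicit Types (u v w : 'rV[R]_n) (a : R).

Lemma dotr_mulmx u v : dotr u v = (u *m v^T) 0 0.
Proof. by rewrite mxE; apply: eq_bigr => j _; rewrite mxE. Qed.

Lemma dotrC u v : dotr u v = dotr v u.
Proof. by apply: eq_bigr => j _; rewrite mulrC. Qed.

Lemma dotrDr u v w : dotr u (v + w) = dotr u v + dotr u w.
Proof. by rewrite -big_split; apply: eq_bigr => j _; rewrite mxE mulrDr. Qed.

Lemma dotrZr a u v : dotr u (a *: v) = a * dotr u v.
Proof. by rewrite /dotr mulr_sumr; apply: eq_bigr => j _; rewrite mxE mulrCA. Qed.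

Lemma sqnormE u : sqnorm u = \sum_j u 0 j ^+ 2.
Proof. by []. Qed.

Lemma sqnorm_ge0 u : 0 <= sqnorm u.
Proof. by apply: sumr_ge0 => j _; rewrite -expr2 sqr_ge0. Qed.

Lemma sqnormZ a u : sqnorm (a *: u) = a ^+ 2 * sqnorm u.
Proof. by rewrite /sqnorm dotrZr dotrC dotrZr mulrA. Qed.

Lemma sqnormD u v : sqnorm (u + v) = sqnorm u + 2 * dotr u v + sqnorm v.
Proof.
by rewrite /sqnorm dotrDr !(dotrC (u + v)) !dotrDr (dotrC v u); ring.
Qed.

End euclidean.

Lemma sqnorm_mxrow (R : realType) (K : nat) (dk : 'I_K -> nat)
    (B : forall k, 'rV[R]_(dk k)) :
  sqnorm (mxrow B) = \sum_(k < K) sqnorm (B k).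
Proof.
rewrite /sqnorm dotr_mulmx tr_mxrow mul_mxrow_mxcol summxE.
by apply: eq_bigr => k _; rewrite dotr_mulmx.
Qed.

Section noisy_gradient_step.
Context {R : realType} {n : nat}.
Context (F : 'rV[R]_n -> R) (gradF : 'rV[R]_n -> 'rV[R]_n) (alpha beta : R).
Context (alpha0 : 0 < alpha) (alpha_beta : alpha <= beta).
Context (sconvex : forall u v,
  F u + dotr (gradF u) (v - u) + alpha / 2 * sqnorm (v - u) <= F v).
Context (smooth : forall u v,
  F v <= F u + dotr (gradF u) (v - u) + beta / 2 * sqnorm (v - u)).

(** Expand the nonnegative square of [gradF u + alpha *: (v - u)] and add [2 * alpha] times strong
    convexity. *)
Lemma polyak_lojasiewicz (u v : 'rV[R]_n) :
  2 * alpha * (F u - F v) <= sqnorm (gradF u).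
Proof.
have := sqnorm_ge0 (gradF u + alpha *: (v - u)).
rewrite sqnormD dotrZr sqnormZ.
have := ler_wpM2l (ltW alpha0) (sconvex u v).
set g := dotr _ _; set s := sqnorm (v - u); set h := sqnorm _; nra.
Qed.

(** With step 1 / beta, the inner product of gradient and noise from the linear term cancels the one
    from the quadratic term; the remaining squared gradient is bounded by [polyak_lojasiewicz]. *)
Lemma noisy_descent (w e wstar : 'rV[R]_n) :
  F (w - beta^-1 *: (gradF w + e)) - F wstar <=
  (1 - alpha / beta) * (F w - F wstar) + (2 * beta)^-1 * sqnorm e.
Proof.
have beta0 : 0 < beta by exact: lt_le_trans alpha_beta.
have := smooth w (w - beta^-1 *: (gradF w + e)).
rewrite (addrC w) addrK -scaleNr dotrZr dotrDr sqnormZ sqnormD.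
rewrite -/(sqnorm (gradF w)).
have := polyak_lojasiewicz w wstar.
set g := sqnorm (gradF w); set s := dotr _ _; set q := sqnorm e.
set D := F w - F wstar => PL.
have -> : F w = F wstar + D by rewrite /D addrC subrK.
have -> : F wstar + D + - beta^-1 * (g + s) +
  beta / 2 * ((- beta^-1) ^+ 2 * (g + 2 * s + q)) =
  F wstar + D - (2 * beta)^-1 * g + (2 * beta)^-1 * q.
  by field; rewrite gt_eqF.
have i0 : 0 <= (2 * beta)^-1 by rewrite invr_ge0 mulr_ge0 ?ltW.
have := ler_wpM2l i0 PL.
have -> : (2 * beta)^-1 * (2 * alpha * D) = alpha / beta * D.
  by field; rewrite gt_eqF.
lra.
Qed.

End noisy_gradient_step.

(** * Measurability *)

Section measurability.
Context {R : realType} {d} {T : measurableType d}.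

(** An open set is a countable union of boxes with rational centres and radii 1 / (k + 1), and the
    preimage of a box is a finite intersection of coordinate conditions. *)
Lemma measurable_continuous_rV {n} (w : T -> 'rV[R]_n) (h : 'rV[R]_n -> R) :
  continuous h -> (forall j, measurable_fun setT (fun t => w t 0 j)) ->
  measurable_fun setT (fun t => h (w t)).
Proof.
move=> ch mw; apply: (measurability _ (RGenOpens.measurableE R)).
move=> _ [_ [l [r ->] <-]]; rewrite setTI; set B := `]l, r[%classic.
have oB : open B by exact: interval_open.
pose O := h @^-1` B.
have oO : open O by exact: open_comp oB => // y _; exact: ch.
pose box (q : 'rV[rat]_n) (k : nat) : set 'rV[R]_n :=
  [set y | forall j, `|y 0 j - ratr (q 0 j)| < k.+1%:R^-1].
pose A (p : 'rV[rat]_n * nat) : set T :=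
  if `[< box p.1 p.2 `<=` O >] then [set t | box p.1 p.2 (w t)] else set0.
have -> : (fun t => h (w t)) @^-1` B = \bigcup_p A p.
  apply/seteqP; split => t; last first.
    by move=> [p _]; rewrite /A; case: asboolP => // sub /= /sub.
  move=> Ot; have /nbhs_ballP[e /= e0 eO] : nbhs (w t) O.
    by apply: open_nbhs_nbhs; split.
  (* Half of [e] suffices: any two points of a box are within two radii in each coordinate. *)
  have [k ke] : exists k : nat, k.+1%:R^-1 < e / 2.
    have /ltr_add_invr[k] : (0 : R) < e / 2 by rewrite divr_gt0.
    by rewrite add0r; exists k.
  have k0 : (0 : R) < k.+1%:R^-1 by rewrite invr_gt0.
  have q_ j : exists q : rat, `|w t 0 j - ratr q| < k.+1%:R^-1.
    have /rat_in_itvoo[q] : w t 0 j < w t 0 j + k.+1%:R^-1 by rewrite ltrDl.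
    rewrite in_itv/= => /andP[q1 q2]; exists q.
    by rewrite distrC gtr0_norm ?subr_gt0// ltrBlDl.
  pose q : 'rV[rat]_n := \row_j projT1 (cid (q_ j)).
  have wq : box q k (w t) by move=> j; rewrite mxE; exact: projT2 (cid (q_ j)).
  exists (q, k) => //; rewrite /A asboolT//=.
  move=> y yq; apply: eO; split => // i j.
  rewrite (ord1 i); change (`|w t 0 j - y 0 j| < e).
  have h1 : `|w t 0 j - ratr (q 0 j)| < k.+1%:R^-1 := wq j.
  have h2 : `|ratr (q 0 j) - y 0 j| < k.+1%:R^-1 by rewrite distrC; exact: yq j.
  apply: le_lt_trans (ler_distD (ratr (q 0 j)) _ _) _; rewrite [e]splitr.
  by apply: ltrD; [exact: lt_trans h1 ke|exact: lt_trans h2 ke].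
apply: countable_bigcupT_measurable => // p; rewrite /A; case: asboolP => // _.
have -> : [set t | box p.1 p.2 (w t)] =
    \big[setI/setT]_(j < n) [set t | `|w t 0 j - ratr (p.1 0 j)| < p.2.+1%:R^-1].
  apply/seteqP; split => t.
    by move=> tb; apply/bigsetI_seqP => j _; exact: tb.
  by move=> /bigsetI_seqP tb j; apply: tb; exact: mem_index_enum.
apply: bigsetI_measurable => j _; rewrite -[X in measurable X]setTI.
have mj : measurable_fun setT (fun t => `|w t 0 j - ratr (p.1 0 j)|).
  by apply: measurableT_comp => //; exact: measurable_funB.
have -> : [set t | `|w t 0 j - ratr (p.1 0 j)| < p.2.+1%:R^-1] =
    (fun t => `|w t 0 j - ratr (p.1 0 j)|) @^-1` `]-oo, p.2.+1%:R^-1[.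
  by apply/seteqP; split => t /=; rewrite in_itv.
exact: mj.
Qed.

(** Sampling the difference quotient at steps 1 / (n + 1) makes the derivative a limit of a
    sequence, as measurability of limits requires. *)
Lemma derive_seq {V : normedModType R} (f : V -> R) (y v : V) :
  derivable f y v ->
  (n.+1%:R * (f (n.+1%:R^-1 *: v + y) - f y)) @[n --> \oo] --> 'D_v f y.
Proof.
move=> df.
have h : (fun n : nat => n.+1%:R^-1 : R) @ \oo --> (0 : R)^'.
  move=> B [e /= e0 eB]; apply: filterS (near_infty_natSinv_lt (PosNum e0)) => n ne.
  apply: eB; last by rewrite invr_eq0 pnatr_eq0.
  by rewrite /= sub0r normrN gtr0_norm.
have := cvg_comp _ _ h df.
by apply: cvg_trans; apply: near_eq_cvg; near=> n; rewrite /= invrK.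
Unshelve. all: by end_near. Qed.

Lemma measurable_derive_rV {n} (f : 'rV[R]_n -> R) (v : 'rV[R]_n)
    (w : T -> 'rV[R]_n) :
  continuous f -> (forall y, derivable f y v) ->
  (forall j, measurable_fun setT (fun t => w t 0 j)) ->
  measurable_fun setT (fun t => 'D_v f (w t)).
Proof.
move=> cf df mw.
apply: (@measurable_fun_cvg _ _ _ _
  (fun m t => m.+1%:R * (f (m.+1%:R^-1 *: v + w t) - f (w t)))).
  move=> m; apply: measurable_funM => //; apply: measurable_funB.
    apply: (measurable_continuous_rV (fun t => m.+1%:R^-1 *: v + w t)) => // j.
    by under eq_fun do rewrite !mxE; exact: measurable_funD.
  exact: measurable_continuous_rV.
by move=> t _; exact: derive_seq.
Qed.

Lemma measurable_derivative (f df : R -> R) :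
  (forall s, is_derive s (1 : R) f (df s)) -> measurable_fun [set: R] df.
Proof.
move=> fdf.
have cf : continuous f.
  by move=> s; apply: differentiable_continuous; apply/derivable1_diffP.
apply: (@measurable_fun_cvg _ _ _ _
  (fun n s => n.+1%:R * (f (n.+1%:R^-1 *: (1 : R) + s) - f s))).
  move=> n; apply: measurable_funM => //; apply: measurable_funB.
    apply: measurableT_comp; first exact: continuous_measurable_fun.
    exact: measurable_funD.
  exact: continuous_measurable_fun.
move=> s _; have [dfs <-] := fdf s.
exact: (@derive_seq R^o).
Qed.

End measurability.

Lemma gradient_coord {R : realType} {n} (f : 'rV[R]_n -> R) (y g : 'rV[R]_n)
  (j : 'I_n) : is_gradient f y g -> 'D_(delta_mx 0 j) f y = g 0 j.
Proof.
move=> [df fg]; rewrite deriveE// fg /dotr (bigD1 j)//= big1 ?addr0.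
  by rewrite mxE !eqxx mulr1.
by move=> i ij; rewrite mxE eqxx/= (negbTE ij) mulr0.
Qed.

Lemma gradient_continuous {R : realType} {n} (f : 'rV[R]_n -> R)
  (g : 'rV[R]_n -> 'rV[R]_n) : (forall y, is_gradient f y (g y)) -> continuous f.
Proof. by move=> fg y; apply: differentiable_continuous; exact: (fg y).1. Qed.

Lemma measurable_gradient {R : realType} {d} {T : measurableType d} {n}
    (f : 'rV[R]_n -> R) (g : 'rV[R]_n -> 'rV[R]_n) (w : T -> 'rV[R]_n) :
  (forall y, is_gradient f y (g y)) ->
  (forall j, measurable_fun setT (fun t => w t 0 j)) ->
  forall j, measurable_fun setT (fun t => g (w t) 0 j).
Proof.
move=> fg mw j; under eq_fun do rewrite -(gradient_coord _ _ _ _ (fg _)).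
apply: measurable_derive_rV => //; first exact: gradient_continuous fg.
by move=> y; apply: diff_derivable; exact: (fg y).1.
Qed.

Lemma ge0_integral_sumEFin {R : realType} {d} {T : measurableType d}
    (P : {measure set T -> \bar R}) {I : Type} (s : seq I) (f : I -> T -> R) :
  (forall i, measurable_fun setT (f i)) -> (forall i t, 0 <= f i t) ->
  (\int[P]_t (\sum_(i <- s) f i t)%:E = \sum_(i <- s) \int[P]_t (f i t)%:E)%E.
Proof.
move=> mf f0; under eq_integral do rewrite -sumEFin.
rewrite ge0_integral_sum//; first by move=> i; exact/measurable_EFinP.
by move=> i t _; rewrite lee_fin.
Qed.

(** * Vertical federated learning *)

Section model.
Context {R : realType} {K L : nat} {dk : 'I_K -> nat}.
Notation V := 'rV[R]_(\sum_(j < K) dk j).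
Context (F : V -> R) (gradF : V -> V) (hgradF : forall w, is_gradient F w (gradF w)).
Context (gk : forall k : 'I_K, 'rV[R]_(dk k) -> 'rV[R]_(dk k) -> R)
  (x : 'I_L -> forall k : 'I_K, 'rV[R]_(dk k))
  (dg : forall k : 'I_K, 'I_L -> 'rV[R]_(dk k) -> 'rV[R]_(dk k))
  (hdg : forall k i u, is_gradient (fun v => gk k v (x i k)) u (dg k i u))
  (G dG : 'I_L -> R -> R)
  (hG : forall i (s : R), is_derive s (1 : R) (G i) (dG i s)).
Context {d} {Omega : measurableType d} (P : probability Omega R).
Context (varUL : nat -> R) (varDL : nat -> 'I_K -> R)
  (hvarUL : forall t, 0 <= varUL t) (hvarDL : forall t k, 0 <= varDL t k)
  (nUL : nat -> 'I_L -> Omega -> R) (nDL : nat -> 'I_K -> 'I_L -> Omega -> R)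
  (hnUL : forall t i, centered_gaussian P (nUL t i) (varUL t))
  (hnDL : forall t k i, centered_gaussian P (nDL t k i) (varDL t k))
  (hind : mutually_independent P (noise_family nUL nDL)).

Let noise := noise_family nUL nDL.

(** The inequality is strict: the iterate at time t uses rounds 0 to t - 1 only, so the noises of
    round t lie outside its past. *)
Definition noise_before (t : nat) : set ((nat * 'I_L) + (nat * 'I_K * 'I_L))%type :=
  [set j | match j with inl (s, _) => (s < t)%N | inr (s, _, _) => (s < t)%N end].

Let history t := past noise (noise_before t).

Lemma measurable_blk {d'} {T : measurableType d'} (w : T -> V) k :
  (forall j, measurable_fun setT (fun om => w om 0 j)) ->
  forall c, measurable_fun setT (fun om => blk (w om) k 0 c).
Proof. by move=> mw c; under eq_fun do rewrite mxE; exact: mw. Qed.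

Lemma measurable_pred_s {d'} {T : measurableType d'} (w : T -> V) i :
  (forall j, measurable_fun setT (fun om => w om 0 j)) ->
  measurable_fun setT (fun om => pred_s K L dk gk x i (w om)).
Proof.
move=> mw; apply: measurable_sum => k.
apply: (measurable_continuous_rV (fun om => blk (w om) k)
  (fun v => gk k v (x i k))); last exact: measurable_blk.
exact: gradient_continuous (hdg k i).
Qed.

Lemma measurable_dG {d'} {T : measurableType d'} (w : T -> V) i :
  (forall j, measurable_fun setT (fun om => w om 0 j)) ->
  measurable_fun setT (fun om => dG i (pred_s K L dk gk x i (w om))).
Proof.
move=> mw; apply: measurableT_comp; last exact: measurable_pred_s.
exact: measurable_derivative (hG i).
Qed.

Lemma measurable_dg {d'} {T : measurableType d'} (w : T -> V) k i c :
  (forall j, measurable_fun setT (fun om => w om 0 j)) ->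
  measurable_fun setT (fun om => dg k i (blk (w om) k) 0 c).
Proof.
by move=> mw; apply: (measurable_gradient _ _ _ (hdg k i)); exact: measurable_blk.
Qed.

Lemma noise_blk_coord (nU : 'I_L -> R) (nD : 'I_K -> 'I_L -> R) (w : V) k c :
  noise_blk K L dk gk x dg dG nU nD w k 0 c =
  L%:R^-1 * \sum_(i < L)
    (dG i (pred_s K L dk gk x i w) * nU i + nD k i) * dg k i (blk w k) 0 c.
Proof.
by rewrite mxE summxE; congr (_ * _); apply: eq_bigr => i _; rewrite mxE.
Qed.

(** * The iterates as a process adapted to the noise *)

Context (beta : R) (w0 : V).

Let W (t : nat) (om : Omega) : V :=
  iterate K L dk gk x dg dG beta gradF w0
    (fun t i => nUL t i om) (fun t k i => nDL t k i om) t.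

Let e (t : nat) (om : Omega) (k : 'I_K) : 'rV[R]_(dk k) :=
  noise_blk K L dk gk x dg dG (fun i => nUL t i om) (fun k i => nDL t k i om)
    (W t om) k.

(** Reads the blockwise update as one gradient step in the full space, where [noisy_descent]
    applies. *)
Lemma mxrow_step (u g : V) (b : R) (E : forall k, 'rV[R]_(dk k)) :
  mxrow (fun k => blk u k - b *: (blk g k + E k)) = u - b *: (g + mxrow E).
Proof. by apply/rowP => j; rewrite !mxE tagnat.sig2K. Qed.

Lemma iterateS t om :
  W t.+1 om = W t om - beta^-1 *: (gradF (W t om) + mxrow (e t om)).
Proof. exact: mxrow_step. Qed.

Lemma iterateS_coord t om j :
  W t.+1 om 0 j = W t om 0 j -
    beta^-1 * (gradF (W t om) 0 j + e t om (tagnat.sig1 j) 0 (tagnat.sig2 j)).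
Proof.
rewrite iterateS.
have subZ (A B : V) : (A - beta^-1 *: B) 0 j = A 0 j - beta^-1 * B 0 j.
  by rewrite !mxE.
have addmxrow (A : V) (B : forall k, 'rV[R]_(dk k)) :
    (A + mxrow B) 0 j = A 0 j + B (tagnat.sig1 j) 0 (tagnat.sig2 j).
  by rewrite !mxE.
by rewrite subZ addmxrow.
Qed.

Lemma noise_beforeS t : noise_before t `<=` noise_before t.+1.
Proof. by move=> [[s i]|[[s k] i]] /= /ltnW. Qed.

Lemma measurable_iterate t j :
  measurable_fun [set: history t] ((fun om => W t om 0 j) : history t -> R).
Proof.
elim: t j => [|t IH] j; first exact: measurable_cst.
have mW i : measurable_fun [set: history t.+1]
    ((fun om => W t om 0 i) : history t.+1 -> R).
  by apply: measurable_past_subset (IH i); exact: noise_beforeS.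
have mU i : measurable_fun [set: history t.+1] (nUL t i : history t.+1 -> R).
  exact: (measurable_noise_past noise (noise_before t.+1) (inl (t, i)) (ltnSn t)).
have mD k i : measurable_fun [set: history t.+1] (nDL t k i : history t.+1 -> R).
  exact: (measurable_noise_past noise (noise_before t.+1) (inr (t, k, i)) (ltnSn t)).
under eq_fun do rewrite iterateS_coord noise_blk_coord.
apply: measurable_funB => //; apply: measurable_funM => //.
apply: measurable_funD; first exact: measurable_gradient hgradF mW j.
apply: measurable_funM => //; apply: measurable_sum => i.
apply: measurable_funM; last exact: measurable_dg.
by apply: measurable_funD => //; apply: measurable_funM => //; exact: measurable_dG.
Qed.

Lemma measurable_iterateT t j : measurable_fun setT (fun om => W t om 0 j).
Proof. exact: (measurable_from_past P noise hind _ _ (measurable_iterate t j)). Qed.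

Lemma measurable_noise_blk t k c : measurable_fun setT (fun om => e t om k 0 c).
Proof.
have mW := measurable_iterateT t.
under eq_fun do rewrite noise_blk_coord.
apply: measurable_funM => //; apply: measurable_sum => i.
apply: measurable_funM; last exact: measurable_dg.
apply: measurable_funD; last exact: (hnDL t k i).1.
by apply: measurable_funM; [exact: measurable_dG|exact: (hnUL t i).1].
Qed.

(** * Second moment of the aggregated noise *)

Let phi1 t k := (\int[P]_om (Phi1 K L dk gk x dg dG (W t om) k)%:E)%E.
Let phi2 t k := (\int[P]_om (Phi2 K L dk dg (W t om) k)%:E)%E.

Lemma weighted_phi_ge0 t k :
  (0 <= (varUL t)%:E * phi1 t k + (varDL t k)%:E * phi2 t k)%E.
Proof.
apply: adde_ge0; apply: mule_ge0; rewrite ?lee_fin//; apply: integral_ge0 => om _.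
  by rewrite lee_fin; apply: sumr_ge0 => i _; rewrite mulr_ge0 ?sqr_ge0 ?sqnorm_ge0.
by rewrite lee_fin; apply: sumr_ge0 => i _; exact: sqnorm_ge0.
Qed.

(** Each coordinate of the block is linear in the noises of round t, with coefficients known from
    the history. Summing the coordinate bounds rebuilds [Phi1] and [Phi2]; averaging gives 1 / L^2
    and the moment bound gives 3. *)
Lemma noise_blk_second_moment t k :
  (\int[P]_om (sqnorm (e t om k))%:E <=
   (3 / L%:R ^+ 2)%:E * ((varUL t)%:E * phi1 t k + (varDL t k)%:E * phi2 t k))%E.
Proof.
have mW := measurable_iterateT t.
pose D om i c := dg k i (blk (W t om) k) 0 c.
pose C om i := dG i (pred_s K L dk gk x i (W t om)).
have mD i c : measurable_fun setT (fun om => D om i c) by exact: measurable_dg.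
have mC i : measurable_fun setT (fun om => C om i) by exact: measurable_dG.
(* The 2 L noises entering block [k] at round [t]: all uplink ones, then the downlink ones of device
   [k]. *)
pose J : seq ((nat * 'I_L) + (nat * 'I_K * 'I_L))%type :=
  [seq inl (t, i) | i <- index_enum 'I_L] ++ [seq inr (t, k, i) | i <- index_enum 'I_L].
have uJ : uniq J.
  rewrite cat_uniq !map_inj_uniq ?index_enum_uniq//; last 2 first.
  - by move=> a b [].
  - by move=> a b [].
  by rewrite andbT; apply/hasPn => _ /mapP[i _ ->]; apply/mapP => -[].
have JS j : j \in J -> ~ noise_before t j.
  by rewrite mem_cat => /orP[] /mapP[i _ ->]; rewrite /noise_before/= ltnn.
pose v (j : ((nat * 'I_L) + (nat * 'I_K * 'I_L))%type) : R :=
  match j with inl (s, _) => varUL s | inr (s, k', _) => varDL s k' end.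
have v0 j : 0 <= v j by case: j => [[s i]|[[s k'] i]] /=.
have gv j : centered_gaussian P (noise j) (v j).
  by case: j => [[s i]|[[s k'] i]] /=.
(* Only the sample index of [j] is read; round and device are fixed to [t] and [k], so every [h c j]
   is measurable for [history t], also off [J]. *)
pose h c (j : ((nat * 'I_L) + (nat * 'I_K * 'I_L))%type) (om : Omega) : R :=
  match j with inl (_, i) => C om i * D om i c | inr (_, _, i) => D om i c end.
have mh c j : measurable_fun [set: history t] (h c j : history t -> R).
  have mWt := measurable_iterate t.
  case: j => [[s i]|[[s k'] i]] /=; last exact: measurable_dg.
  by apply: measurable_funM; [exact: measurable_dG|exact: measurable_dg].
have eE om c : e t om k 0 c = L%:R^-1 * \sum_(j <- J) h c j om * noise j om.
  rewrite noise_blk_coord big_cat/= !big_map/= -big_split/=; congr (_ * _).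
  by apply: eq_bigr => i _ /=; rewrite mulrDl mulrAC (mulrC (nDL _ _ _ _)).
pose a i c := (\int[P]_om ((C om i * D om i c) ^+ 2)%:E)%E.
pose b i c := (\int[P]_om (D om i c ^+ 2)%:E)%E.
have a0 i c : (0 <= a i c)%E by apply: integral_ge0 => om _; rewrite lee_fin sqr_ge0.
have b0 i c : (0 <= b i c)%E by apply: integral_ge0 => om _; rewrite lee_fin sqr_ge0.
have moment c : (\int[P]_om ((\sum_(j <- J) h c j om * noise j om) ^+ 2)%:E <=
    \sum_(i < L) (3 * varUL t)%:E * a i c + \sum_(i < L) (3 * varDL t k)%:E * b i c)%E.
  apply: (le_trans (past_sum_second_moment P noise hind _ J v (h c) uJ JS v0 gv (mh c))).
  by rewrite big_cat !big_map.
have phi1E : phi1 t k = (\sum_(c < dk k) \sum_(i < L) a i c)%E.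
  rewrite exchange_big/= -/(phi1 t k) /phi1 /Phi1 ge0_integral_sumEFin; last 2 first.
  - move=> i; apply: measurable_funM; first exact: measurable_funX (mC i).
    by apply: measurable_sum => c; apply: measurable_funM; exact: mD.
  - by move=> i om; rewrite mulr_ge0 ?sqr_ge0 ?sqnorm_ge0.
  - apply: eq_bigr => i _; rewrite -ge0_integral_sumEFin; last 2 first.
    + by move=> c; apply: measurable_funX; exact: measurable_funM.
    + by move=> c om; exact: sqr_ge0.
    + apply: eq_integral => om _; congr (_%:E); rewrite sqnormE mulr_sumr.
      by apply: eq_bigr => c _; rewrite exprMn.
have phi2E : phi2 t k = (\sum_(c < dk k) \sum_(i < L) b i c)%E.
  rewrite exchange_big/= -/(phi2 t k) /phi2 /Phi2 ge0_integral_sumEFin; last 2 first.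
  - by move=> i; apply: measurable_sum => c; apply: measurable_funM; exact: mD.
  - by move=> i om; exact: sqnorm_ge0.
  - apply: eq_bigr => i _; rewrite -ge0_integral_sumEFin; last 2 first.
    + by move=> c; exact: measurable_funX.
    + by move=> c om; exact: sqr_ge0.
    + by apply: eq_integral => om _; congr (_%:E); rewrite sqnormE.
have Linv0 : 0 <= L%:R^-1 ^+ 2 :> R by exact: sqr_ge0.
have -> : (\int[P]_om (sqnorm (e t om k))%:E = \sum_(c < dk k) (L%:R^-1 ^+ 2)%:E *
    \int[P]_om ((\sum_(j <- J) h c j om * noise j om) ^+ 2)%:E)%E.
  transitivity (\int[P]_om (\sum_(c < dk k) (e t om k 0 c) ^+ 2)%:E)%E.
    by apply: eq_integral => om _; rewrite sqnormE.
  rewrite ge0_integral_sumEFin; last 2 first.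
  - by move=> c; apply: measurable_funX; exact: measurable_noise_blk.
  - by move=> c om; exact: sqr_ge0.
  apply: eq_bigr => c _; rewrite -ge0_integralZl//; last 2 first.
  - apply/measurable_EFinP/measurable_funX; apply: measurable_sum => j.
    apply: measurable_funM; last exact: hind.1.
    exact: (measurable_from_past P noise hind _ _ (mh c j)).
  - by move=> om _; rewrite lee_fin sqr_ge0.
  by apply: eq_integral => om _; rewrite eE exprMn EFinM.
(* In the extended reals, products distribute over these sums because all terms are nonnegative. *)
have -> : ((3 / L%:R ^+ 2)%:E * ((varUL t)%:E * phi1 t k + (varDL t k)%:E * phi2 t k) =
  \sum_(c < dk k) (L%:R^-1 ^+ 2)%:E *
   (\sum_(i < L) (3 * varUL t)%:E * a i c + \sum_(i < L) (3 * varDL t k)%:E * b i c))%E.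
  rewrite phi1E phi2E.
  have s0 (f : 'I_L -> 'I_(dk k) -> \bar R) c : (forall i c, 0 <= f i c)%E ->
    (0 <= \sum_(i < L) f i c)%E by move=> f0; apply: sume_ge0.
  rewrite !ge0_sume_distrr; try by move=> *; exact: s0.
  rewrite -big_split/= ge0_sume_distrr; last first.
    by move=> c _; apply: adde_ge0; apply: mule_ge0; rewrite ?lee_fin//; exact: s0.
  apply: eq_bigr => c _.
  rewrite -!ge0_sume_distrr; try by move=> *; exact: a0 || exact: b0.
  rewrite !EFinM -!muleA -ge0_muleDr; last 2 first.
  - by apply: mule_ge0; rewrite ?lee_fin//; exact: s0.
  - by apply: mule_ge0; rewrite ?lee_fin//; exact: s0.
  rewrite !muleA -!EFinM; congr (_%:E * _)%E; rewrite -exprVn; ring.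
apply: lee_sum => c _; apply: lee_wpmul2l; first by rewrite lee_fin.
exact: moment.
Qed.

(** * Recursion for the expected optimality gap *)

Context (alpha : R) (alpha0 : 0 < alpha) (alpha_beta : alpha <= beta).
Context (sconvex : forall u v,
  F u + dotr (gradF u) (v - u) + alpha / 2 * sqnorm (v - u) <= F v).
Context (smooth : forall u v,
  F v <= F u + dotr (gradF u) (v - u) + beta / 2 * sqnorm (v - u)).
Context (wstar : V) (hmin : forall w, F wstar <= F w).

Let rho := 1 - alpha / beta.
Let gap t := (\int[P]_om (F (W t om) - F wstar)%:E)%E.
Let noise_coef : R := 3 / (2 * L%:R ^+ 2 * beta).
Let B t := (\sum_(k < K) ((varUL t)%:E * phi1 t k + (varDL t k)%:E * phi2 t k))%E.

Lemma rho_ge0 : 0 <= rho.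
Proof.
by rewrite /rho subr_ge0 ler_pdivrMr ?mul1r//; exact: lt_le_trans alpha_beta.
Qed.

(** The pathwise descent inequality is integrated. Minimality of [wstar] makes the gap nonnegative,
    so the integral splits even if it is infinite. *)
Lemma gap_step t : (gap t.+1 <= rho%:E * gap t + noise_coef%:E * B t)%E.
Proof.
have beta0 : 0 < beta by exact: lt_le_trans alpha_beta.
have i0 : 0 <= (2 * beta)^-1 by rewrite invr_ge0 mulr_ge0// ltW.
have r0 := rho_ge0.
have mF s : measurable_fun setT (fun om => F (W s om) - F wstar).
  apply: measurable_funB => //.
  apply: (measurable_continuous_rV (W s) F (gradient_continuous _ _ hgradF)).
  exact: measurable_iterateT.
have F0 s om : 0 <= F (W s om) - F wstar by rewrite subr_ge0.
have me k : measurable_fun setT (fun om => sqnorm (e t om k)).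
  by apply: measurable_sum => c; apply: measurable_funM; exact: measurable_noise_blk.
have mse : measurable_fun setT (fun om => \sum_(k < K) sqnorm (e t om k)).
  exact: measurable_sum.
have se0 om : 0 <= \sum_(k < K) sqnorm (e t om k).
  by apply: sumr_ge0 => k _; exact: sqnorm_ge0.
apply: (@le_trans _ _ (\int[P]_om ((rho * (F (W t om) - F wstar))%:E +
    ((2 * beta)^-1 * \sum_(k < K) sqnorm (e t om k))%:E))%E).
  apply: ge0_le_integral => //.
  - by move=> om _; rewrite lee_fin.
  - exact/measurable_EFinP.
  - apply: emeasurable_funD; apply/measurable_EFinP; exact: measurable_funM.
  - move=> om _; rewrite -EFinD lee_fin -sqnorm_mxrow iterateS.
    exact: (noisy_descent F gradF alpha beta).
rewrite ge0_integralD//; last 4 first.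
- by move=> om _; rewrite lee_fin mulr_ge0.
- by apply/measurable_EFinP; exact: measurable_funM.
- by move=> om _; rewrite lee_fin mulr_ge0.
- by apply/measurable_EFinP; exact: measurable_funM.
under eq_integral do rewrite EFinM.
rewrite ge0_integralZl//; last 2 first.
- exact/measurable_EFinP.
- by move=> om _; rewrite lee_fin.
apply: leeD2l.
under eq_integral do rewrite EFinM.
rewrite ge0_integralZl//; last 2 first.
- exact/measurable_EFinP.
- by move=> om _; rewrite lee_fin.
rewrite ge0_integral_sumEFin//; last by move=> k om; exact: sqnorm_ge0.
(* The factor 1 / (2 beta) comes from the descent step, 3 / L^2 from the noise moment. *)
have -> : noise_coef = (2 * beta)^-1 * (3 / L%:R ^+ 2).
  by rewrite /noise_coef !invfM; ring.
rewrite EFinM -muleA; apply: lee_wpmul2l; first by rewrite lee_fin.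
rewrite /B ge0_sume_distrr; last by move=> k _; exact: weighted_phi_ge0.
by apply: lee_sum => k _; exact: noise_blk_second_moment.
Qed.

(** Unrolls [gap_step] by induction from the deterministic starting point, where the expectation is
    that of a constant. *)
Lemma gap_bound t :
  (gap t <= (rho ^+ t * (F w0 - F wstar))%:E +
            noise_coef%:E * \sum_(s < t) ((rho ^+ (t - s - 1))%:E * B s))%E.
Proof.
have r0 := rho_ge0.
have cst0 : 0 <= noise_coef.
  rewrite divr_ge0// mulr_ge0// ?mulr_ge0// ?exprn_ge0//.
  exact: ltW (lt_le_trans alpha0 alpha_beta).
have B0 s : (0 <= B s)%E.
  by apply: sume_ge0 => k _; exact: weighted_phi_ge0.
have S0 s : (0 <= \sum_(u < s) ((rho ^+ (s - u - 1))%:E * B u))%E.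
  by apply: sume_ge0 => u _; rewrite mule_ge0// lee_fin exprn_ge0.
elim: t => [|t IH].
  rewrite big_ord0 mule0 adde0 expr0 mul1r /gap /W/= integral_cst//.
  have PT : ((F w0 - F wstar)%:E * P [set: Omega] = (F w0 - F wstar)%:E)%E.
    by rewrite probability_setT mule1.
  by rewrite -[leRHS]PT; exact: lexx.
apply: (le_trans (gap_step t)).
have rho0 : (0 <= rho%:E)%E by rewrite lee_fin.
apply: (@le_trans _ _ (rho%:E * ((rho ^+ t * (F w0 - F wstar))%:E +
  noise_coef%:E * \sum_(s < t) ((rho ^+ (t - s - 1))%:E * B s)) +
  noise_coef%:E * B t)%E).
  by apply: leeD2r; exact: lee_wpmul2l.
have D0 : (0 <= (rho ^+ t * (F w0 - F wstar))%:E)%E.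
  by rewrite lee_fin mulr_ge0 ?subr_ge0//; exact: exprn_ge0.
rewrite (ge0_muleDr _ D0); last by rewrite mule_ge0// lee_fin.
rewrite -EFinM mulrA -exprS -addeA; apply: leeD2l.
rewrite muleCA -ge0_muleDr//; last by rewrite mule_ge0.
(* The new summand s = t has exponent t + 1 - t - 1 = 0. *)
rewrite big_ord_recr/= subSnn subnn expr0 mul1e.
rewrite ge0_sume_distrr; last by move=> s _; rewrite mule_ge0// lee_fin exprn_ge0.
rewrite le_eqVlt; apply/orP; left; apply/eqP; congr (_ * (_ + _))%E.
(* Since s < t, the truncated t - s - 1 loses nothing, and the extra factor [rho] raises it to t + 1
   - s - 1. *)
apply: eq_bigr => s _; rewrite muleA -EFinM -exprS.
by rewrite /= !subn1 prednK ?subn_gt0// subSn ?(ltnW (ltn_ord s)).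
Qed.

End model.

Theorem theorem1 (R : realType) (K L : nat) (dk : 'I_K -> nat)
  (hK : (1 <= K)%N) (hL : (1 <= L)%N)
  (* sample losses, regularizers, regularization weight, objective *)
  (f : 'I_L -> 'rV[R]_(\sum_(j < K) dk j) -> R)
  (r : 'I_K -> 'rV[R]_(\sum_(j < K) dk j) -> R) (lam : R)
  (F : 'rV[R]_(\sum_(j < K) dk j) -> R)
  (hF : forall w, F w = (L%:R)^-1 * \sum_(i < L) f i w + lam * \sum_(k < K) r k w)
  (* local prediction functions g_k(., x_{i,k}), continuously differentiable *)
  (gk : forall k : 'I_K, 'rV[R]_(dk k) -> 'rV[R]_(dk k) -> R)
  (x : 'I_L -> forall k : 'I_K, 'rV[R]_(dk k))
  (dg : forall k : 'I_K, 'I_L -> 'rV[R]_(dk k) -> 'rV[R]_(dk k))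
  (hdg : forall k i u, is_gradient (fun v => gk k v (x i k)) u (dg k i u))
  (hdg_cont : forall k i, continuous (dg k i))
  (* differentiable G_i with derivative G_i' *)
  (G dG : 'I_L -> R -> R)
  (hG : forall i (s : R), is_derive s (1 : R) (G i) (dG i s))
  (* vertical-FL structure of the partial gradients of f_i *)
  (hf : forall i w k, is_partial_gradient (f i) w k
          (G i (pred_s K L dk gk x i w) *: dg k i (blk w k)))
  (* gradient of F, strong convexity, smoothness, minimizer *)
  (gradF : 'rV[R]_(\sum_(j < K) dk j) -> 'rV[R]_(\sum_(j < K) dk j))
  (hgradF : forall w, is_gradient F w (gradF w))
  (alpha beta : R) (halpha : 0 < alpha) (hab : alpha <= beta)
  (hsc : forall u v, F u + dotr (gradF u) (v - u) + alpha / 2 * sqnorm (v - u) <= F v)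
  (hsm : forall u v, F v <= F u + dotr (gradF u) (v - u) + beta / 2 * sqnorm (v - u))
  (wstar : 'rV[R]_(\sum_(j < K) dk j)) (hmin : forall w, F wstar <= F w)
  (* initial point *)
  (w0 : 'rV[R]_(\sum_(j < K) dk j))
  (* probability space and communication noises *)
  (d0 : measure_display) (Omega : measurableType d0) (P : probability Omega R)
  (varUL : nat -> R) (varDL : nat -> 'I_K -> R)
  (hvarUL : forall t, 0 <= varUL t) (hvarDL : forall t k, 0 <= varDL t k)
  (nUL : nat -> 'I_L -> Omega -> R) (nDL : nat -> 'I_K -> 'I_L -> Omega -> R)
  (hnUL : forall t i, centered_gaussian P (nUL t i) (varUL t))
  (hnDL : forall t k i, centered_gaussian P (nDL t k i) (varDL t k))
  (hind : mutually_independent P (noise_family nUL nDL))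
  (T : nat) (hT : (1 <= T)%N) :
  let w := fun (t : nat) (om : Omega) =>
    iterate K L dk gk x dg dG beta gradF w0
      (fun t i => nUL t i om) (fun t k i => nDL t k i om) t in
  let rho := 1 - alpha / beta in
  (\int[P]_om ((F (w T om) - F wstar)%:E)
   <= (rho ^+ T * (F w0 - F wstar))%:E
      + (3 / (2 * (L%:R) ^+ 2 * beta))%:E *
        \sum_(t < T) ((rho ^+ (T - t - 1))%:E *
          \sum_(k < K) ((varUL t)%:E * \int[P]_om ((Phi1 K L dk gk x dg dG (w t om) k)%:E)
                      + (varDL t k)%:E * \int[P]_om ((Phi2 K L dk dg (w t om) k)%:E))))%E.
Proof.
exact: (gap_bound F gradF hgradF gk x dg hdg G dG hG P varUL varDL hvarUL hvarDL
  nUL nDL hnUL hnDL hind beta w0 alpha halpha hab hsc hsm wstar hmin T).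
Qed.
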